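(* Let $S$ be an involutive commutative semiring. The dagger category $\mathrm{TRel}(\mathbf{Mod}_S,\mathrm{cp})$ of tame relations for the comparison cluster $\mathrm{cp}_X\colon\overline{\mathcal{M}_S(X)}\otimes\mathcal{M}_S(X)\to S$, indexed by sets $X$ and given by $\mathrm{cp}_X(\varphi'\otimes\varphi)=\sum_x\overline{\varphi'(x)}\cdot\varphi(x)$, has sets as objects and as morphisms $X\to Y$ the multirelations $r\colon X\times Y\to S$ for which the two maps obtained by abstraction satisfy: $$\left\{\begin{array}{l}\Lambda(r)\colon Y\to S^X\ \text{factors through}\ Y\to\mathcal{M}_S(X),\\ \Lambda(r^\dagger)\colon X\to S^Y\ \text{factors through}\ X\to\mathcal{M}_S(Y).\end{array}\right.$$ More concretely, this means that for each $x\in X$ there are only finitely many $y\in Y$ with $r(x,y)\neq 0$, and vice-versa (for each $y\in Y$ there are only finitely many $x\in X$ with $r(x,y)\neq 0$).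
   Context: An involutive commutative semiring $S$ is a commutative semiring with a semiring map $\overline{(-)}\colon S\to S$ such that $\overline{\overline{s}}=s$. $\mathbf{Mod}_S$ is the category of $S$-modules (commutative monoids with a scalar multiplication by $S$ that preserves the additive structure in each argument and is a monoid action) and $S$-linear maps, with tensor $\otimes$ classifying bilinear maps and tensor unit $S$. Its involution sends a module $M$ to $\overline{M}$, with the same elements and addition but with scalar multiplication $s\cdot_{\overline{M}}v=\overline{s}\cdot_M v$; $S$ is self-conjugate via $\overline{(-)}\colon\overline{S}\to S$. $\mathcal{M}_S(X)=\{\varphi\colon X\to S\mid\varphi(x)\neq0\text{ for only finitely many }x\}$ is the free $S$-module on the set $X$ (multisets over $S$). Functions $r\colon X\times Y\to S$ (''multirelations'') correspond bijectively to linear maps $\widehat r\colon\overline{\mathcal{M}_S(X)}\otimes\mathcal{M}_S(Y)\to S$, via $\widehat r(\varphi\otimes\psi)=\sum_{x,y}\overline{\varphi(x)}\cdot r(x,y)\cdot\psi(y)$. Here $r^\dagger(y,x)=\overline{r(x,y)}$, $\Lambda(r)(y)=r(-,y)$ and $\Lambda(r^\dagger)(x)=r^\dagger(-,x)$. $\mathrm{TRel}(\mathbf{Mod}_S,\mathrm{cp})$ has sets as objects. Morphisms $X\to Y$ are tame relations: linear maps $r\colon\overline{\mathcal{M}_S(X)}\otimes\mathcal{M}_S(Y)\to S$ for which there are (necessarily unique) linear maps $r_*\colon\mathcal{M}_S(X)\to\mathcal{M}_S(Y)$ and $r^*\colon\mathcal{M}_S(Y)\to\mathcal{M}_S(X)$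 with $\mathrm{cp}_Y\circ(\overline{r_*}\otimes\mathrm{id})=r=\mathrm{cp}_X\circ(\mathrm{id}\otimes r^* )$. Identities are the $\mathrm{cp}_X$, composition is $s\bullet r=s\circ(\overline{r_*}\otimes\mathrm{id})$, and the dagger is $r^\dagger=\mathrm{cp}_X\circ(\overline{r^*}\otimes\mathrm{id})$. The claim identifies tame relations with multirelations via $r\leftrightarrow\widehat r$. In terms of multirelations, composition is $(s\bullet r)(x,z)=\sum_y r(x,y)\cdot s(y,z)$ and the dagger is $r^\dagger(y,x)=\overline{r(x,y)}$; the category is also written $\mathbf{BifMRel}_S$. *)

(* Defs.v *)
From HB Require Import structures.
From mathcomp Require Import all_boot all_algebra generic_quotient.
From mathcomp Require Import boolp classical_sets functions cardinality fsbigop.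

Set Implicit Arguments.
Unset Strict Implicit.
Unset Printing Implicit Defensive.

Import GRing.Theory.
Local Open Scope classical_set_scope.
Local Open Scope quotient_scope.
Local Open Scope ring_scope.

(* The trivial semiring (1 = 0) is allowed. *)
HB.mixin Record hasInvolution S of GRing.ComPzSemiRing S := {
  sconj : {rmorphism S -> S};
  sconjK : involutive sconj
}.
#[short(type="involutiveComSemiRingType")]
HB.structure Definition InvolutiveComSemiRing :=
  { S of hasInvolution S & GRing.ComPzSemiRing S }.

Lemma linear_ext (S : pzSemiRingType) (U V : lSemiModType S)
  (f g : {linear U -> V}) : f =1 g -> f = g.
Proof.
case: f => f [[fD] [fZ]]; case: g => g [[gD] [gZ]] /= /funext fg.
by subst g; do 3!f_equal; exact: Prop_irrelevance.
Qed.

Section Tensor.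
Variables (S : comPzSemiRingType) (M N : lSemiModType S).

(* The tensor product is the quotient of the free commutative monoid on      *)
(* M * N (formal finite sums, represented by lists) by the congruence making *)
(* (m, n) |-> m (x) n bilinear.                                              *)
Inductive tensor_rel : seq (M * N) -> seq (M * N) -> Prop :=
| tensor_refl s : tensor_rel s s
| tensor_sym s t : tensor_rel s t -> tensor_rel t s
| tensor_trans s t u : tensor_rel s t -> tensor_rel t u -> tensor_rel s u
| tensor_cat s s' t t' :
    tensor_rel s s' -> tensor_rel t t' -> tensor_rel (s ++ t) (s' ++ t')
| tensor_catC s t : tensor_rel (s ++ t) (t ++ s)
| tensor_addl m m' n : tensor_rel [:: (m + m', n)] [:: (m, n); (m', n)]
| tensor_addr m n n' : tensor_rel [:: (m, n + n')] [:: (m, n); (m, n')]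
| tensor_zerol n : tensor_rel [:: (0, n)] [::]
| tensor_zeror m : tensor_rel [:: (m, 0)] [::]
| tensor_scale a m n : tensor_rel [:: (a *: m, n)] [:: (m, a *: n)].

Definition tensor_relb s t := `[< tensor_rel s t >].

Lemma tensor_relb_equiv : equiv_class_of tensor_relb.
Proof.
split.
- by move=> s; apply/asboolP/tensor_refl.
- by move=> s t; apply/asbool_equiv_eq; split; exact: tensor_sym.
- move=> t s u /asboolP st /asboolP tu; apply/asboolP; exact: tensor_trans st tu.
Qed.

Canonical tensor_equiv := EquivRelPack tensor_relb_equiv.

Definition tensor := {eq_quot tensor_equiv}.
HB.instance Definition _ := Choice.on tensor.

Definition tclass (s : seq (M * N)) : tensor := \pi_tensor s.

Lemma tclassP s t : tensor_rel s t <-> tclass s = tclass t.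
Proof.
split=> [st|/eqquotP/asboolP//]; apply/eqquotP/asboolP.
exact: st.
Qed.

Lemma tclass_repr (u : tensor) : tclass (repr u) = u.
Proof. exact: reprK. Qed.

Lemma tclass_ind (P : tensor -> Prop) : (forall s, P (tclass s)) -> forall u, P u.
Proof. by move=> H u; rewrite -(tclass_repr u). Qed.

Lemma repr_tclass s : tensor_rel (repr (tclass s)) s.
Proof. by apply/tclassP; rewrite tclass_repr. Qed.

Definition tadd (u v : tensor) : tensor := tclass (repr u ++ repr v).

Definition scale_seq (a : S) (s : seq (M * N)) : seq (M * N) :=
  [seq (a *: p.1, p.2) | p <- s].

Definition tscale (a : S) (u : tensor) : tensor := tclass (scale_seq a (repr u)).

Lemma tadd_class s t : tadd (tclass s) (tclass t) = tclass (s ++ t).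
Proof. by apply/tclassP/tensor_cat; exact: repr_tclass. Qed.

Lemma scale_seq_rel a s t :
  tensor_rel s t -> tensor_rel (scale_seq a s) (scale_seq a t).
Proof.
elim=> {s t} /=.
- by move=> s; exact: tensor_refl.
- by move=> s t _; exact: tensor_sym.
- by move=> s t u _ st _ tu; exact: tensor_trans st tu.
- by move=> s s' t t' _ h _ h'; rewrite /scale_seq !map_cat; exact: tensor_cat.
- by move=> s t; rewrite /scale_seq !map_cat; exact: tensor_catC.
- by move=> m m' n; rewrite scalerDr; exact: tensor_addl.
- by move=> m n n'; exact: tensor_addr.
- by move=> n; rewrite scaler0; exact: tensor_zerol.
- by move=> m; exact: tensor_zeror.
- by move=> b m n; rewrite scalerA mulrC -scalerA; exact: tensor_scale.
Qed.

Lemma tscale_class a s : tscale a (tclass s) = tclass (scale_seq a s).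
Proof. by apply/tclassP/scale_seq_rel; exact: repr_tclass. Qed.

Let taddA : associative tadd.
Proof.
by elim/tclass_ind=> s; elim/tclass_ind=> t; elim/tclass_ind=> u;
  rewrite !tadd_class catA.
Qed.

Let taddC : commutative tadd.
Proof.
elim/tclass_ind=> s; elim/tclass_ind=> t; rewrite !tadd_class.
exact/tclassP/tensor_catC.
Qed.

Let tadd0 : left_id (tclass [::]) tadd.
Proof. by elim/tclass_ind=> s; rewrite tadd_class. Qed.

HB.instance Definition _ := GRing.isNmodule.Build tensor taddA taddC tadd0.

Let tscaleA a b u : tscale a (tscale b u) = tscale (a * b) u.
Proof.
elim/tclass_ind: u => s; rewrite !tscale_class /scale_seq -map_comp.
by congr tclass; apply: eq_map => p /=; rewrite scalerA.
Qed.

Let tscale0 u : tscale 0 u = 0.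
Proof.
elim/tclass_ind: u => s; rewrite tscale_class; apply/tclassP.
elim: s => [|p s IH] /=; first exact: tensor_refl.
rewrite scale0r -[[::]]/([::] ++ [::] : seq (M * N)).
exact: (tensor_cat (s := [:: (0, p.2)]) (tensor_zerol _) IH).
Qed.

Let tscale1 : left_id 1 tscale.
Proof.
elim/tclass_ind=> s; rewrite tscale_class; congr tclass.
by rewrite -[RHS]map_id; apply: eq_map => -[m n] /=; rewrite scale1r.
Qed.

Let tscaleDr : right_distributive tscale +%R.
Proof.
move=> a; elim/tclass_ind=> s; elim/tclass_ind=> t.
by rewrite -[_ + _]/(tadd _ _) tadd_class !tscale_class -[RHS]/(tadd _ _)
  tadd_class /scale_seq map_cat.
Qed.

Let tscaleDl u : {morph tscale^~ u : a b / a + b}.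
Proof.
elim/tclass_ind: u => s a b; rewrite !tscale_class.
rewrite -[RHS]/(tadd _ _) tadd_class; apply/tclassP.
elim: s => [|p s IH] /=; first exact: tensor_refl.
rewrite scalerDl.
apply: (tensor_trans (tensor_cat (s := [:: _]) (tensor_addl _ _ _) IH)).
rewrite -[X in tensor_rel X _]/([:: (a *: p.1, p.2)] ++
  (([:: (b *: p.1, p.2)] ++ scale_seq a s) ++ scale_seq b s)).
rewrite -[X in tensor_rel _ X]/([:: (a *: p.1, p.2)] ++
  (scale_seq a s ++ ([:: (b *: p.1, p.2)] ++ scale_seq b s))).
rewrite [X in tensor_rel _ (_ ++ X)]catA.
do 2!(apply: tensor_cat; try exact: tensor_refl).
exact: tensor_catC.
Qed.

HB.instance Definition _ := GRing.Nmodule_isLSemiModule.Build S tensor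
  tscaleA tscale0 tscale1 tscaleDr tscaleDl.

Definition tens (m : M) (n : N) : tensor := tclass [:: (m, n)].

Lemma tclass_sum s : tclass s = \sum_(p <- s) tens p.1 p.2.
Proof.
elim: s => [|[m n] s IH]; first by rewrite big_nil.
by rewrite big_cons -IH /= -[RHS]/(tadd _ _) tadd_class.
Qed.

Section Lift.
Variable P : lSemiModType S.

Record bilinear_map (f : M -> N -> P) : Prop := BilinearMap {
  bilinDl : forall n, {morph f^~ n : m m' / m + m'};
  bilinDr : forall m, {morph f m : n n' / n + n'};
  bilinZl : forall a m n, f (a *: m) n = a *: f m n;
  bilinZr : forall a m n, f m (a *: n) = a *: f m n
}.

Definition tlift_fun (f : M -> N -> P) (u : tensor) : P :=
  \sum_(p <- repr u) f p.1 p.2.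

Variables (f : M -> N -> P) (bf : bilinear_map f).

Lemma tlift_fun_class s : tlift_fun f (tclass s) = \sum_(p <- s) f p.1 p.2.
Proof.
suff inv t u : tensor_rel t u ->
    \sum_(p <- t) f p.1 p.2 = \sum_(p <- u) f p.1 p.2.
  exact/inv/repr_tclass.
elim=> {t u} //.
- by move=> t u v _ -> _ ->.
- by move=> t t' u u' _ h _ h'; rewrite !big_cat /= h h'.
- by move=> t u; rewrite !big_cat /= addrC.
- by move=> m m' n; rewrite !big_cons !big_nil /= !addr0 (bilinDl bf).
- by move=> m n n'; rewrite !big_cons !big_nil /= !addr0 (bilinDr bf).
- by move=> n; rewrite !big_cons !big_nil /= addr0 -(scale0r 0) (bilinZl bf) !scale0r.
- by move=> m; rewrite !big_cons !big_nil /= addr0 -(scale0r 0) (bilinZr bf) !scale0r.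
- by move=> a m n; rewrite !big_cons !big_nil /= !addr0 (bilinZl bf) (bilinZr bf).
Qed.

Lemma tlift_semilinear : GRing.semilinear_for *:%R (tlift_fun f).
Proof.
split.
- move=> a; elim/tclass_ind=> s; rewrite -[a *: _]/(tscale _ _) tscale_class.
  rewrite !tlift_fun_class big_map scaler_sumr.
  by apply: eq_bigr => p _ /=; rewrite (bilinZl bf).
- elim/tclass_ind=> s; elim/tclass_ind=> t.
  by rewrite -[tclass s + _]/(tadd _ _) tadd_class !tlift_fun_class big_cat.
Qed.

HB.instance Definition _ :=
  GRing.isSemilinear.Build S tensor P *:%R (tlift_fun f) tlift_semilinear.

Definition tlift : {linear tensor -> P} := tlift_fun f.

Lemma tlift_tens m n : tlift (tens m n) = f m n.
Proof. by rewrite /= tlift_fun_class big_seq1. Qed.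

End Lift.

Lemma tensor_ext (P : lSemiModType S) (f g : {linear tensor -> P}) :
  (forall m n, f (tens m n) = g (tens m n)) -> f = g.
Proof.
move=> fg; apply: linear_ext; elim/tclass_ind=> s; rewrite tclass_sum !linear_sum.
by apply: eq_bigr => p _; rewrite fg.
Qed.

Lemma tens_bilinear : bilinear_map tens.
Proof.
split.
- by move=> n m m'; rewrite -[RHS]/(tadd _ _) tadd_class; apply/tclassP/tensor_addl.
- by move=> m n n'; rewrite -[RHS]/(tadd _ _) tadd_class; apply/tclassP/tensor_addr.
- by move=> a m n; rewrite -[RHS]/(tscale _ _) tscale_class.
- move=> a m n; rewrite -[RHS]/(tscale _ _) tscale_class.
  by apply/tclassP/tensor_sym/tensor_scale.
Qed.

End Tensor.

Section TensorMap.
Variables (S : comPzSemiRingType) (M M' N N' : lSemiModType S).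
Variables (f : {linear M -> M'}) (g : {linear N -> N'}).

Lemma tmap_bilinear : bilinear_map (fun m n => tens (f m) (g n)).
Proof.
have [Dl Dr Zl Zr] := tens_bilinear M' N'.
split=> [n m m'|m n n'|a m n|a m n].
- by rewrite linearD Dl.
- by rewrite linearD Dr.
- by rewrite linearZ Zl.
- by rewrite linearZ Zr.
Qed.

Definition tmap : {linear tensor M N -> tensor M' N'} := tlift tmap_bilinear.

Lemma tmap_tens m n : tmap (tens m n) = tens (f m) (g n).
Proof. exact: tlift_tens. Qed.

End TensorMap.

Section ConjugateModule.
Variable S : involutiveComSemiRingType.

Definition conjMod (M : lSemiModType S) : Type := M.

Section Module.
Variable M : lSemiModType S.

HB.instance Definition _ := GRing.Nmodule.on (conjMod M).

Let cscale (a : S) (v : conjMod M) : conjMod M := sconj a *: (v : M).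

Let cscaleA a b v : cscale a (cscale b v) = cscale (a * b) v.
Proof. by rewrite /cscale scalerA rmorphM. Qed.
Let cscale0 v : cscale 0 v = 0.
Proof. by rewrite /cscale rmorph0 scale0r. Qed.
Let cscale1 : left_id 1 cscale.
Proof. by move=> v; rewrite /cscale rmorph1 scale1r. Qed.
Let cscaleDr : right_distributive cscale +%R.
Proof. by move=> a u v; rewrite /cscale [LHS]scalerDr. Qed.
Let cscaleDl v : {morph cscale^~ v : a b / a + b}.
Proof. by move=> a b; rewrite /cscale rmorphD [LHS]scalerDl. Qed.

HB.instance Definition _ := GRing.Nmodule_isLSemiModule.Build S (conjMod M)
  cscaleA cscale0 cscale1 cscaleDr cscaleDl.

Lemma conjMod_scaleE (a : S) (v : M) :
  a *: (v : conjMod M) = (sconj a *: v : M).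
Proof. by []. Qed.

End Module.

Definition conj_fun (M N : lSemiModType S) (f : M -> N) :
  conjMod M -> conjMod N := f.

Lemma conj_fun_semilinear (M N : lSemiModType S) (f : {linear M -> N}) :
  GRing.semilinear_for *:%R (conj_fun f).
Proof.
split; first by move=> a v; rewrite /conj_fun !conjMod_scaleE linearZ.
by move=> u v; rewrite /conj_fun [LHS]linearD.
Qed.

HB.instance Definition _ (M N : lSemiModType S) (f : {linear M -> N}) :=
  GRing.isSemilinear.Build S (conjMod M) (conjMod N) *:%R (conj_fun f)
    (conj_fun_semilinear f).

Definition conjLin (M N : lSemiModType S) (f : {linear M -> N}) :
  {linear conjMod M -> conjMod N} := conj_fun f.

End ConjugateModule.

(* Summation over an arbitrary set; it is 0 by convention when F does not    *)
(* have finite support.                                                      *)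
Definition fsum (R : nmodType) (X : Type) (F : X -> R) : R :=
  \sum_(x \in [set: {classic X}]) F x.

Lemma fsum_seq (R : nmodType) (X : Type) (F : X -> R) (s : seq {classic X}) :
  uniq s -> (forall x : {classic X}, x \notin s -> F x = 0) ->
  fsum F = \sum_(x <- s) F x.
Proof.
move=> us Fs; rewrite /fsum (fsbigE s) => //=; last by move=> i _; exact: Fs.
by apply: eq_bigl => x; rewrite in_setT.
Qed.

Section Multisets.
Variable S : comPzSemiRingType.

Record multiset (X : Type) := Multiset {
  mult :> X -> S;
  mult_finite : finite_set [set x | mult x != 0]
}.

Section Module.
Variable X : Type.
Local Notation MX := (multiset X).

Lemma multiset_ext (p q : MX) : p =1 q -> p = q.
Proof.
case: p q => [p fp] [q fq] /= /funext pq; subst q.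
by congr Multiset; exact: Prop_irrelevance.
Qed.

HB.instance Definition _ := gen_eqMixin MX.
HB.instance Definition _ := gen_choiceMixin MX.

Lemma mzero_finite : finite_set [set x : X | (0 : S) != 0].
Proof. by apply: (sub_finite_set _ (finite_set0 X)) => x /=; rewrite eqxx. Qed.

Lemma madd_finite (p q : MX) : finite_set [set x | p x + q x != 0].
Proof.
apply: (@sub_finite_set _ _ ([set x | p x != 0] `|` [set x | q x != 0])).
  move=> x /=; case: (eqVneq (p x) 0) => [->|]; last by left.
  by rewrite add0r; right.
by rewrite finite_setU; split; exact: mult_finite.
Qed.

Lemma mscale_finite (a : S) (p : MX) : finite_set [set x | a * p x != 0].
Proof.
apply: sub_finite_set (mult_finite p) => x /=.
by apply: contra_neq => ->; rewrite mulr0.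
Qed.

Definition mzero : MX := Multiset mzero_finite.
Definition madd (p q : MX) : MX := Multiset (madd_finite p q).
Definition mscale (a : S) (p : MX) : MX := Multiset (mscale_finite a p).

Let maddA : associative madd.
Proof. by move=> p q r; apply: multiset_ext => x /=; rewrite addrA. Qed.
Let maddC : commutative madd.
Proof. by move=> p q; apply: multiset_ext => x /=; rewrite addrC. Qed.
Let madd0 : left_id mzero madd.
Proof. by move=> p; apply: multiset_ext => x /=; rewrite add0r. Qed.

HB.instance Definition _ := GRing.isNmodule.Build MX maddA maddC madd0.

Let mscaleA a b p : mscale a (mscale b p) = mscale (a * b) p.
Proof. by apply: multiset_ext => x /=; rewrite mulrA. Qed.
Let mscale0 p : mscale 0 p = 0.
Proof. by apply: multiset_ext => x /=; rewrite mul0r. Qed.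
Let mscale1 : left_id 1 mscale.
Proof. by move=> p; apply: multiset_ext => x /=; rewrite mul1r. Qed.
Let mscaleDr : right_distributive mscale +%R.
Proof. by move=> a p q; apply: multiset_ext => x /=; rewrite mulrDr. Qed.
Let mscaleDl p : {morph mscale^~ p : a b / a + b}.
Proof. by move=> a b; apply: multiset_ext => x /=; rewrite mulrDl. Qed.

HB.instance Definition _ := GRing.Nmodule_isLSemiModule.Build S MX
  mscaleA mscale0 mscale1 mscaleDr mscaleDl.

Lemma multDE (p q : MX) x : (p + q) x = p x + q x. Proof. by []. Qed.
Lemma multZE (a : S) (p : MX) x : (a *: p) x = a * p x. Proof. by []. Qed.

Lemma delta_finite (x : X) :
  finite_set [set y | (if `[< x = y >] then 1 else 0 : S) != 0].
Proof.
apply: (@sub_finite_set _ _ [set x]) (finite_set1 x) => y /=.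
by case: asboolP => [->//|]; rewrite eqxx.
Qed.

Definition delta (x : X) : MX := Multiset (delta_finite x).

Definition covers (s : seq {classic X}) (p : MX) : Prop :=
  forall x : {classic X}, x \notin s -> p x = 0.

Lemma covers2 (p q : MX) :
  exists s : seq {classic X}, [/\ uniq s, covers s p & covers s q].
Proof.
have cov (r : MX) : exists s, covers s r.
  have /(@finite_seqP {classic X})[s sE] := mult_finite r.
  exists s => x; apply: contraNeq => rx.
  by have : [set` s] x by rewrite -sE.
have [[s sp] [t tq]] := (cov p, cov q).
exists (undup (s ++ t)); split; first exact: undup_uniq.
- by move=> x; rewrite mem_undup mem_cat negb_or => /andP[/sp].
- by move=> x; rewrite mem_undup mem_cat negb_or => /andP[_ /tq].
Qed.

Lemma coversD s (p q : MX) : covers s p -> covers s q -> covers s (p + q).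
Proof. by move=> sp sq x xs; rewrite multDE sp ?sq ?addr0. Qed.

Lemma coversZ s a (p : MX) : covers s p -> covers s (a *: p).
Proof. by move=> sp x xs; rewrite multZE sp ?mulr0. Qed.

End Module.
End Multisets.

Notation form S X Y :=
  {linear tensor (conjMod (multiset S X)) (multiset S Y) -> S^o}.

Section Forms.
Variable S : involutiveComSemiRingType.
Local Notation M X := (multiset S X).

Section Hat.
Variables (X Y : Type) (r : X -> Y -> S).

Definition hat_fun (phi : conjMod (M X)) (psi : M Y) : S^o :=
  fsum (fun x => fsum (fun y => sconj (mult phi x) * r x y * psi y)).

Lemma hat_funE s t (phi : M X) (psi : M Y) :
  uniq s -> uniq t -> covers s phi -> covers t psi ->
  hat_fun phi psi = \sum_(x <- s) \sum_(y <- t) sconj (phi x) * r x y * psi y.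
Proof.
move=> us ut sp tp; rewrite /hat_fun (fsum_seq us) => [|x xs].
  apply: eq_bigr => x _; rewrite (fsum_seq ut) // => y yt.
  by rewrite tp // mulr0.
rewrite (fsum_seq ut) => [|y yt]; last by rewrite tp // mulr0.
by rewrite big1 // => y _; rewrite sp // rmorph0 !mul0r.
Qed.

Lemma hat_bilinear : bilinear_map hat_fun.
Proof.
split.
- move=> psi phi phi'; have [t [ut tp _]] := covers2 psi psi.
  have [s [us sp sp']] := covers2 (phi : M X) (phi' : M X).
  rewrite !(hat_funE us ut) //; last exact: coversD.
  rewrite -[RHS]big_split; apply: eq_bigr => x _ /=.
  rewrite -big_split; apply: eq_bigr => y _ /=.
  by rewrite rmorphD !mulrDl.
- move=> phi psi psi'; have [t [ut tp tp']] := covers2 psi psi'.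
  have [s [us sp _]] := covers2 (phi : M X) (phi : M X).
  rewrite !(hat_funE us ut) //; last exact: coversD.
  rewrite -[RHS]big_split; apply: eq_bigr => x _ /=.
  rewrite -big_split; apply: eq_bigr => y _ /=.
  by rewrite mulrDr.
- move=> a phi psi; have [t [ut tp _]] := covers2 psi psi.
  have [s [us sp _]] := covers2 (phi : M X) (phi : M X).
  rewrite conjMod_scaleE !(hat_funE us ut) //; last exact: coversZ.
  rewrite -[RHS]/(_ * _) mulr_sumr; apply: eq_bigr => x _ /=.
  rewrite mulr_sumr; apply: eq_bigr => y _ /=.
  by rewrite rmorphM sconjK !mulrA.
- move=> a phi psi; have [t [ut tp _]] := covers2 psi psi.
  have [s [us sp _]] := covers2 (phi : M X) (phi : M X).
  rewrite !(hat_funE us ut) //; last exact: coversZ.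
  rewrite -[RHS]/(_ * _) mulr_sumr; apply: eq_bigr => x _ /=.
  rewrite mulr_sumr; apply: eq_bigr => y _ /=.
  by rewrite mulrCA.
Qed.

Definition hat : form S X Y := tlift hat_bilinear.

End Hat.

Section Comparison.
Variable X : Type.

Definition cp_fun (phi' : conjMod (M X)) (phi : M X) : S^o :=
  fsum (fun x => sconj (mult phi' x) * phi x).

Lemma cp_funE s (phi' phi : M X) : uniq s -> covers s phi' \/ covers s phi ->
  cp_fun phi' phi = \sum_(x <- s) sconj (phi' x) * phi x.
Proof.
move=> us sp; apply: (fsum_seq us) => x xs.
by case: sp => [->|->]; rewrite // ?rmorph0 ?mul0r ?mulr0.
Qed.

Lemma cp_bilinear : bilinear_map cp_fun.
Proof.
split.
- move=> phi p q; have [s [us sp _]] := covers2 phi phi.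
  rewrite !(cp_funE us); try by right.
  by rewrite -[RHS]big_split; apply: eq_bigr => x _; rewrite rmorphD mulrDl.
- move=> phi p q; have [s [us sp _]] := covers2 (phi : M X) (phi : M X).
  rewrite !(cp_funE us); try by left.
  by rewrite -[RHS]big_split; apply: eq_bigr => x _; rewrite mulrDr.
- move=> a p q; have [s [us sp _]] := covers2 q q.
  rewrite conjMod_scaleE !(cp_funE us); try by right.
  rewrite -[RHS]/(_ * _) mulr_sumr; apply: eq_bigr => x _ /=.
  by rewrite rmorphM sconjK mulrA.
- move=> a p q; have [s [us sp _]] := covers2 (p : M X) (p : M X).
  rewrite !(cp_funE us); try by left.
  rewrite -[RHS]/(_ * _) mulr_sumr; apply: eq_bigr => x _ /=.
  by rewrite mulrCA.
Qed.

Definition cp : form S X X := tlift cp_bilinear.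

Lemma cp_sym (p q : M X) : cp_fun q p = sconj (cp_fun p q).
Proof.
have [s [us sp sq]] := covers2 p q.
rewrite !(cp_funE us); try by left.
by rewrite rmorph_sum; apply: eq_bigr => x _; rewrite rmorphM sconjK mulrC.
Qed.

Lemma cp_deltal (x : X) (p : M X) : cp_fun (delta S x) p = p x.
Proof.
rewrite (@cp_funE [:: x : {classic X}]) //; last first.
  left=> y; rewrite inE /= => yx; case: asboolP => // xy.
  by rewrite xy eqxx in yx.
by rewrite big_seq1 /=; case: asboolP => // _; rewrite rmorph1 mul1r.
Qed.

Lemma cp_deltar (x : X) (p : M X) : cp_fun p (delta S x) = sconj (p x).
Proof. by rewrite cp_sym cp_deltal. Qed.

End Comparison.
End Forms.

Record daggerCategory := DaggerCategory {
  ob : Type;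
  hom : ob -> ob -> Type;
  idm : forall X, hom X X;
  comp : forall X Y Z, hom Y Z -> hom X Y -> hom X Z;
  dag : forall X Y, hom X Y -> hom Y X;
  comp1f : forall X Y (f : hom X Y), comp (idm Y) f = f;
  compf1 : forall X Y (f : hom X Y), comp f (idm X) = f;
  compA : forall X Y Z W (h : hom Z W) (g : hom Y Z) (f : hom X Y),
    comp h (comp g f) = comp (comp h g) f;
  dag1 : forall X, dag (idm X) = idm X;
  dagM : forall X Y Z (g : hom Y Z) (f : hom X Y),
    dag (comp g f) = comp (dag f) (dag g);
  dagK : forall X Y (f : hom X Y), dag (dag f) = f
}.
Arguments idm {d} X.
Arguments comp {d X Y Z} g f.
Arguments dag {d X Y} f.

Record is_dagger_iso (C D : daggerCategory) (F0 : ob C -> ob D)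
    (F : forall X Y : ob C, hom X Y -> hom (F0 X) (F0 Y)) : Prop :=
  IsDaggerIso {
    iso_ob : bijective F0;
    iso_hom : forall X Y, bijective (@F X Y);
    iso_id : forall X, F X X (idm X) = idm (F0 X);
    iso_comp : forall X Y Z (g : hom Y Z) (f : hom X Y),
      F X Z (comp g f) = comp (F Y Z g) (F X Y f);
    iso_dag : forall X Y (f : hom X Y), F Y X (dag f) = dag (F X Y f)
  }.

Section TameRelations.
Variable S : involutiveComSemiRingType.
Local Notation M X := (multiset S X).
Local Notation ctens phi psi :=
  (@tens S (conjMod (multiset S _)) (multiset S _) phi psi).

(* f and g are the maps written r_* and r^*; lower and upper below choose    *)
(* them for a tame r. The choice is irrelevant, see lower_unique and         *)
(* upper_unique.                                                             *)
Definition is_tame_pair (X Y : Type) (r : form S X Y)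
    (f : {linear M X -> M Y}) (g : {linear M Y -> M X}) : Prop :=
  (cp S Y \o tmap (conjLin f) idfun = r :> (_ -> _)) /\
  (r = cp S X \o tmap idfun g :> (_ -> _)).

Definition tame (X Y : Type) (r : form S X Y) : Prop :=
  exists f g, is_tame_pair r f g.

Definition trel (X Y : Type) : Type := {r : form S X Y | tame r}.

Definition lower (X Y : Type) (r : trel X Y) : {linear M X -> M Y} :=
  projT1 (cid (svalP r)).
Definition upper (X Y : Type) (r : trel X Y) : {linear M Y -> M X} :=
  projT1 (cid (projT2 (cid (svalP r)))).

Lemma trelP (X Y : Type) (r : trel X Y) :
  is_tame_pair (sval r) (lower r) (upper r).
Proof. exact: (projT2 (cid (projT2 (cid (svalP r))))). Qed.

Lemma trel_ext (X Y : Type) (r s : trel X Y) :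
  (forall phi psi, sval r (ctens phi psi) = sval s (ctens phi psi)) -> r = s.
Proof.
case: r s => [r rt] [s st] /= rs.
have {}rs : r = s by apply: tensor_ext.
subst s.
by congr exist; exact: Prop_irrelevance.
Qed.

Lemma tmapl_tens X Y Z (f : {linear M X -> M Y}) (s : form S Y Z) phi psi :
  (s \o tmap (conjLin f) idfun) (ctens phi psi) = s (ctens (f phi) psi).
Proof.
have E := tmap_tens (conjLin f) (idfun : {linear M Z -> M Z}) phi psi.
exact: (f_equal s E).
Qed.

Lemma tmapr_tens X Y (g : {linear M Y -> M X}) phi psi :
  (cp S X \o tmap idfun g) (ctens phi psi) = cp_fun phi (g psi).
Proof.
have E := tmap_tens (idfun : {linear conjMod (M X) -> conjMod (M X)}) g phi psi.
exact: etrans (f_equal (cp S X) E) (tlift_tens (@cp_bilinear S X) phi (g psi)).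
Qed.

Lemma cp_tens X (phi psi : M X) : cp S X (ctens phi psi) = cp_fun phi psi.
Proof. exact: tlift_tens. Qed.

Lemma tame_pairE (X Y : Type) (r : form S X Y) f g :
  is_tame_pair r f g <->
  (forall phi psi, cp_fun (f phi) psi = r (ctens phi psi)) /\
  (forall phi psi, r (ctens phi psi) = cp_fun phi (g psi)).
Proof.
split=> -[rf rg]; split.
- by move=> phi psi; rewrite -rf tmapl_tens cp_tens.
- by move=> phi psi; rewrite rg tmapr_tens.
- pose h : {linear _ -> _} := cp S Y \o tmap (conjLin f) idfun.
  suff -> : r = h by [].
  by apply: tensor_ext => phi psi; rewrite -rf -cp_tens -tmapl_tens.
- pose h : {linear _ -> _} := cp S X \o tmap idfun g.
  suff -> : r = h by [].
  by apply: tensor_ext => phi psi; rewrite rg -tmapr_tens.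
Qed.

Lemma lowerE X Y (r : trel X Y) phi psi :
  cp_fun (lower r phi) psi = sval r (ctens phi psi).
Proof. by have /tame_pairE[-> _] := trelP r. Qed.

Lemma upperE X Y (r : trel X Y) phi psi :
  cp_fun phi (upper r psi) = sval r (ctens phi psi).
Proof. by have /tame_pairE[_ ->] := trelP r. Qed.

Lemma lower_unique X Y (r : trel X Y) (f : M X -> M Y) :
  (forall phi psi, cp_fun (f phi) psi = sval r (ctens phi psi)) ->
  lower r =1 f.
Proof.
move=> rf phi; apply: multiset_ext => y; apply: (can_inj (@sconjK S)).
by rewrite -!cp_deltar lowerE rf.
Qed.

Lemma upper_unique X Y (r : trel X Y) (g : M Y -> M X) :
  (forall phi psi, cp_fun phi (g psi) = sval r (ctens phi psi)) ->
  upper r =1 g.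
Proof.
by move=> rg psi; apply: multiset_ext => x; rewrite -!cp_deltal upperE rg.
Qed.

Lemma trel_id_tame X : tame (cp S X).
Proof.
by exists idfun, idfun; apply/tame_pairE; split=> phi psi; rewrite cp_tens.
Qed.

Definition trel_id X : trel X X := exist _ (cp S X) (@trel_id_tame X).

Definition trel_comp_form X Y Z (s : trel Y Z) (r : trel X Y) : form S X Z :=
  sval s \o tmap (conjLin (lower r)) idfun.

Lemma trel_comp_tens X Y Z (s : trel Y Z) (r : trel X Y) phi psi :
  trel_comp_form s r (ctens phi psi) = sval s (ctens (lower r phi) psi).
Proof. exact: tmapl_tens. Qed.

Lemma trel_comp_tame X Y Z (s : trel Y Z) (r : trel X Y) :
  tame (trel_comp_form s r).
Proof.
exists (lower s \o lower r), (upper r \o upper s); apply/tame_pairE.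
split=> phi psi; rewrite trel_comp_tens; first exact: lowerE.
by rewrite -upperE lowerE -upperE.
Qed.

Definition trel_comp X Y Z (s : trel Y Z) (r : trel X Y) : trel X Z :=
  exist _ (trel_comp_form s r) (trel_comp_tame s r).

Definition trel_dag_form X Y (r : trel X Y) : form S Y X :=
  cp S X \o tmap (conjLin (upper r)) idfun.

Lemma trel_dag_tens X Y (r : trel X Y) phi psi :
  trel_dag_form r (ctens phi psi) = cp_fun (upper r phi) psi.
Proof. exact: etrans (tmapl_tens _ _ _ _) (cp_tens _ _). Qed.

Lemma trel_dag_tame X Y (r : trel X Y) : tame (trel_dag_form r).
Proof.
exists (upper r), (lower r); apply/tame_pairE.
split=> phi psi; rewrite trel_dag_tens //.
by rewrite cp_sym upperE -lowerE -cp_sym.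
Qed.

Definition trel_dag X Y (r : trel X Y) : trel Y X :=
  exist _ (trel_dag_form r) (trel_dag_tame r).

Lemma lower_id X : lower (trel_id X) =1 id.
Proof. by apply: lower_unique => phi psi; rewrite cp_tens. Qed.

Lemma upper_id X : upper (trel_id X) =1 id.
Proof. by apply: upper_unique => phi psi; rewrite cp_tens. Qed.

Lemma lower_comp X Y Z (s : trel Y Z) (r : trel X Y) :
  lower (trel_comp s r) =1 lower s \o lower r.
Proof.
by apply: lower_unique => phi psi; rewrite lowerE -trel_comp_tens.
Qed.

Lemma upper_comp X Y Z (s : trel Y Z) (r : trel X Y) :
  upper (trel_comp s r) =1 upper r \o upper s.
Proof.
apply: upper_unique => phi psi.
by rewrite [RHS]trel_comp_tens -upperE lowerE -upperE.
Qed.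

Lemma lower_dag X Y (r : trel X Y) : lower (trel_dag r) =1 upper r.
Proof. by apply: lower_unique => phi psi; rewrite -trel_dag_tens. Qed.

Lemma upper_dag X Y (r : trel X Y) : upper (trel_dag r) =1 lower r.
Proof.
apply: upper_unique => phi psi; rewrite [RHS]trel_dag_tens.
by rewrite cp_sym lowerE -upperE -cp_sym.
Qed.

Definition TRel : daggerCategory.
Proof.
refine (@DaggerCategory Type trel trel_id trel_comp trel_dag _ _ _ _ _ _).
- move=> X Y r; apply: trel_ext => phi psi.
  by rewrite [LHS]trel_comp_tens cp_tens lowerE.
- move=> X Y r; apply: trel_ext => phi psi.
  by rewrite [LHS]trel_comp_tens lower_id.
- move=> X Y Z W t s r; apply: trel_ext => phi psi.
  by rewrite [LHS]trel_comp_tens [RHS]trel_comp_tens [RHS]trel_comp_tens lower_comp.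
- move=> X; apply: trel_ext => phi psi.
  by rewrite [LHS]trel_dag_tens upper_id cp_tens.
- move=> X Y Z s r; apply: trel_ext => phi psi.
  rewrite [LHS]trel_dag_tens [RHS]trel_comp_tens [RHS]trel_dag_tens.
  by rewrite upper_comp lower_dag.
- move=> X Y r; apply: trel_ext => phi psi.
  by rewrite [LHS]trel_dag_tens upper_dag lowerE.
Defined.

End TameRelations.

Section Multirelations.
Variable S : involutiveComSemiRingType.

Definition Lambda (X Y : Type) (r : X -> Y -> S) : Y -> (X -> S) :=
  fun y x => r x y.

Definition mdag (X Y : Type) (r : X -> Y -> S) : Y -> X -> S :=
  fun y x => sconj (r x y).

(* mcomp s r is the composite s after r. All sums that occur are finite when *)
(* r and s satisfy bifactors.                                                *)
Definition mcomp (X Y Z : Type) (s : Y -> Z -> S) (r : X -> Y -> S) :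
  X -> Z -> S := fun x z => fsum (fun y => r x y * s y z).

Definition mid (X : Type) : X -> X -> S :=
  fun x x' => if `[< x = x' >] then 1 else 0.

(* h : A -> (X -> S) factors through the inclusion of M_S(X) in S^X. *)
Definition factors_through_multiset (A X : Type) (h : A -> (X -> S)) : Prop :=
  exists g : A -> multiset S X, h = (fun a => mult (g a)).

Definition bifactors (X Y : Type) (r : X -> Y -> S) : Prop :=
  factors_through_multiset (Lambda r) /\
  factors_through_multiset (Lambda (mdag r)).

Definition bifinite (X Y : Type) (r : X -> Y -> S) : Prop :=
  (forall x, finite_set [set y | r x y != 0]) /\
  (forall y, finite_set [set x | r x y != 0]).

Definition bifmrel (X Y : Type) : Type := {r : X -> Y -> S | bifactors r}.

Lemma mdagK X Y (r : X -> Y -> S) : mdag (mdag r) = r.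
Proof. by apply: funext => x; apply: funext => y; rewrite /mdag sconjK. Qed.

Lemma sconj_fsum (X : Type) (F : X -> S) :
  sconj (fsum F) = fsum (fun x => sconj (F x)).
Proof.
rewrite /fsum rmorph_sum /finite_support /=.
suff -> : F @^-1` [set~ 0] = (fun x => sconj (F x)) @^-1` [set~ 0] by [].
apply/seteqP; split=> x /= Fx F0; apply: Fx; last by rewrite F0 rmorph0.
by rewrite -[F x]sconjK F0 rmorph0.
Qed.

Lemma factors_finite (A X : Type) (h : A -> (X -> S)) :
  factors_through_multiset h -> forall a, finite_set [set x | h a x != 0].
Proof. by move=> [g ->] a; exact: mult_finite. Qed.

Lemma finite_factors (A X : Type) (h : A -> (X -> S)) :
  (forall a, finite_set [set x | h a x != 0]) -> factors_through_multiset h.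
Proof. by move=> fin; exists (fun a => Multiset (fin a)). Qed.

Lemma mdag_comp X Y Z (s : Y -> Z -> S) (r : X -> Y -> S) :
  mdag (mcomp s r) = mcomp (mdag r) (mdag s).
Proof.
apply: funext => z; apply: funext => x.
rewrite /mdag /mcomp sconj_fsum; congr fsum.
by apply: funext => y; rewrite rmorphM mulrC.
Qed.

Lemma mcomp_factors X Y Z (s : Y -> Z -> S) (r : X -> Y -> S) :
  factors_through_multiset (Lambda s) -> factors_through_multiset (Lambda r) ->
  factors_through_multiset (Lambda (mcomp s r)).
Proof.
move=> /factors_finite fs /factors_finite fr; apply: finite_factors => z.
apply: (@sub_finite_set _ _
  (\bigcup_(y in [set y | s y z != 0]) [set x | r x y != 0])).
  move=> x /= rs; apply: contrapT => nxy; move: rs => /eqP; apply.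
  rewrite /Lambda /mcomp (@fsum_seq _ _ _ [::]) ?big_nil // => y _.
  case: (eqVneq (s y z) 0) => [->|syz]; first by rewrite mulr0.
  case: (eqVneq (r x y) 0) => [->|rxy]; first by rewrite mul0r.
  by case: nxy; exists y.
by apply: bigcup_finite => [|y _]; [exact: fs|exact: fr].
Qed.

Lemma mid_dag X : mdag (@mid X) = @mid X.
Proof.
apply: funext => x; apply: funext => y; rewrite /mdag /mid.
case: asboolP => [->|nyx]; first by rewrite asboolT // rmorph1.
by rewrite asboolF ?rmorph0 // => xy; apply: nyx.
Qed.

Lemma mid_bifactors X : bifactors (@mid X).
Proof.
have fin : factors_through_multiset (Lambda (@mid X)).
  apply: finite_factors => y; apply: sub_finite_set (finite_set1 y) => x /=.
  by rewrite /Lambda /mid; case: asboolP => [->|]; rewrite ?eqxx.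
by split; rewrite ?mid_dag.
Qed.

Definition bif_id X : bifmrel X X := exist _ (@mid X) (mid_bifactors X).

Lemma bif_comp_subproof X Y Z (s : bifmrel Y Z) (r : bifmrel X Y) :
  bifactors (mcomp (sval s) (sval r)).
Proof.
have [[s1 s2] [r1 r2]] := (svalP s, svalP r).
by split; rewrite ?mdag_comp; apply: mcomp_factors.
Qed.

Definition bif_comp X Y Z (s : bifmrel Y Z) (r : bifmrel X Y) : bifmrel X Z :=
  exist _ (mcomp (sval s) (sval r)) (bif_comp_subproof s r).

Lemma bif_dag_subproof X Y (r : bifmrel X Y) : bifactors (mdag (sval r)).
Proof. by have [r1 r2] := svalP r; split; rewrite ?mdagK. Qed.

Definition bif_dag X Y (r : bifmrel X Y) : bifmrel Y X :=
  exist _ (mdag (sval r)) (bif_dag_subproof r).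

Lemma bifmrel_ext X Y (r s : bifmrel X Y) : sval r =2 sval s -> r = s.
Proof.
case: r s => [r rf] [s sf] /= rs.
have {}rs : r = s by apply: funext => x; apply: funext => y.
by subst s; congr exist; exact: Prop_irrelevance.
Qed.

Lemma finite_cover (X : Type) (F : X -> S) : finite_set [set x | F x != 0] ->
  exists s : seq {classic X}, uniq s /\ forall x : {classic X}, x \notin s -> F x = 0.
Proof.
move=> fin; have [s [us sp _]] := covers2 (Multiset fin) (Multiset fin).
by exists s.
Qed.

Definition BifMRel : daggerCategory.
Proof.
refine (@DaggerCategory Type bifmrel bif_id bif_comp bif_dag _ _ _ _ _ _).
- move=> X Y r; apply: bifmrel_ext => x y /=; rewrite /mcomp /mid.
  rewrite (@fsum_seq _ _ _ [:: y : {classic Y}]) // => [|z].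
    by rewrite big_seq1 asboolT // mulr1.
  by rewrite inE => /eqP zy; rewrite asboolF ?mulr0.
- move=> X Y r; apply: bifmrel_ext => x y /=; rewrite /mcomp /mid.
  rewrite (@fsum_seq _ _ _ [:: x : {classic X}]) // => [|z].
    by rewrite big_seq1 asboolT // mul1r.
  by rewrite inE => /eqP zx; rewrite asboolF ?mul0r // => xz; apply: zx.
- move=> X Y Z W t s r; apply: bifmrel_ext => x w /=; rewrite /mcomp.
  have [_ /factors_finite/(_ x) /finite_cover[ys [uys ysP]]] := svalP r.
  have {}ysP y : y \notin ys -> sval r x y = 0.
    move=> /ysP r0; rewrite -[LHS]sconjK.
    by have -> : sconj (sval r x y) = 0 by []; rewrite rmorph0.
  have [/factors_finite/(_ w) /finite_cover[zs [uzs zsP]] _] := svalP t.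
  have {}zsP z : z \notin zs -> sval t z w = 0 by move=> /zsP.
  rewrite (fsum_seq uzs) => [|z zz]; last by rewrite zsP // mulr0.
  rewrite (fsum_seq uys) => [|y yy]; last by rewrite ysP // mul0r.
  transitivity (\sum_(z <- zs) \sum_(y <- ys)
      sval r x y * sval s y z * sval t z w).
    apply: eq_bigr => z _; rewrite (fsum_seq uys) ?mulr_suml // => y yy.
    by rewrite ysP // mul0r.
  rewrite exchange_big; apply: eq_bigr => y _ /=.
  rewrite (fsum_seq uzs) => [|z zz]; last by rewrite zsP // mulr0.
  by rewrite mulr_sumr; apply: eq_bigr => z _; rewrite mulrA.
- by move=> X; apply: bifmrel_ext => x y /=; rewrite mid_dag.
- by move=> X Y Z s r; apply: bifmrel_ext => z x /=; rewrite mdag_comp.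
- by move=> X Y r; apply: bifmrel_ext => x y /=; rewrite mdagK.
Defined.

End Multirelations.

(* Main.v *)
(** A form is determined by its matrix of values on pairs of basis multisets
    [delta x], [delta y], since for a tame form
    [r(phi, psi) = cp(phi, upper r psi)], and the coefficients of
    [upper r psi] are in turn the values [cp(lower r (delta x), psi)].  The rows
    and columns of the matrix are [lower r (delta x)] (up to conjugation) and
    [upper r (delta y)], hence finitely supported; conversely, finitely supported
    rows and columns extend linearly to maps giving [lower] and [upper]. *)

From HB Require Import structures.
From mathcomp Require Import all_boot all_algebra.
From mathcomp Require Import boolp classical_sets functions cardinality fsbigop.
Require Import Defs.


Set Implicit Arguments.
Unset Strict Implicit.
Unset Printing Implicit Defensive.

Import GRing.Theory.
Local Open Scope classical_set_scope.
Local Open Scope ring_scope.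

Section LinearExtension.
Variables (S : comPzSemiRingType) (X Y : Type) (g : X -> multiset S Y).

(** Universal property of the free module on [X]. The sum is genuine, not the default 0, because
    [phi] has finite support. *)
Definition mext (phi : multiset S X) : multiset S Y :=
  fsum (fun x => phi x *: g x).

Lemma mult_sum (I : Type) (s : seq I) (F : I -> multiset S Y) (y : Y) :
  (\sum_(i <- s) F i : multiset S Y) y = \sum_(i <- s) F i y.
Proof. by elim/big_rec2: _ => // i _ p _ <-. Qed.

(** The list may exceed the support of [phi], so two multisets can share one list; additivity of
    [mext] rests on this. *)
Lemma mext_seq (s : seq {classic X}) (phi : multiset S X) :
  uniq s -> covers s phi -> mext phi = \sum_(x <- s) phi x *: g x.
Proof. by move=> us sp; apply: fsum_seq => // x /sp ->; rewrite scale0r. Qed.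

Lemma mext_semilinear : GRing.semilinear_for *:%R mext.
Proof.
split=> [a p|p q].
  have [s [us sp _]] := covers2 p p.
  rewrite !(mext_seq us) //; last exact: coversZ.
  by rewrite scaler_sumr; apply: eq_bigr => x _; rewrite scalerA.
have [s [us sp sq]] := covers2 p q.
rewrite !(mext_seq us) //; last exact: coversD.
by rewrite -big_split; apply: eq_bigr => x _ /=; rewrite scalerDl.
Qed.

HB.instance Definition _ :=
  GRing.isSemilinear.Build S (multiset S X) (multiset S Y) *:%R mext
    mext_semilinear.

Lemma mextE (s : seq {classic X}) (phi : multiset S X) (y : Y) :
  uniq s -> covers s phi -> mext phi y = \sum_(x <- s) phi x * g x y.
Proof. by move=> us sp; rewrite (mext_seq us sp) mult_sum. Qed.

End LinearExtension.

Section TameMatrices.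
Variable S : involutiveComSemiRingType.
Local Notation M X := (multiset S X).
Local Notation ctens phi psi :=
  (@tens S (conjMod (multiset S _)) (multiset S _) phi psi).

Lemma hat_tens (X Y : Type) (r : X -> Y -> S) (phi : M X) (psi : M Y) :
  hat r (ctens phi psi) = hat_fun r phi psi.
Proof. exact: tlift_tens. Qed.

Definition form_matrix (X Y : Type) (r : form S X Y) (x : X) (y : Y) : S :=
  r (ctens (delta S x) (delta S y)).

Lemma covers_delta (X : Type) (x : X) :
  covers [:: x : {classic X}] (delta S x).
Proof.
move=> y; rewrite inE /= => yx; case: asboolP => // xy.
by rewrite xy eqxx in yx.
Qed.

Lemma hatK (X Y : Type) (r : X -> Y -> S) : form_matrix (hat r) = r.
Proof.
apply: funext => x; apply: funext => y; rewrite /form_matrix hat_tens.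
rewrite (hat_funE _ _ _ (@covers_delta X x) (@covers_delta Y y)) // !big_seq1 /=.
by rewrite !asboolT // rmorph1 mul1r mulr1.
Qed.

Lemma upper_delta (X Y : Type) (r : trel S X Y) (x : X) (y : Y) :
  upper r (delta S y) x = form_matrix (sval r) x y.
Proof. by rewrite -cp_deltal upperE. Qed.

(** The conjugation appears because [lower r] feeds the conjugated argument of [cp]. *)
Lemma lower_delta (X Y : Type) (r : trel S X Y) (x : X) (y : Y) :
  sconj (lower r (delta S x) y) = form_matrix (sval r) x y.
Proof. by rewrite -cp_deltar lowerE. Qed.

Lemma trel_matrix_inj (X Y : Type) (r s : trel S X Y) :
  form_matrix (sval r) = form_matrix (sval s) -> r = s.
Proof.
move=> rs; apply: trel_ext => phi psi; rewrite -!upperE; congr cp_fun.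
apply: multiset_ext => x; rewrite -!cp_deltal !upperE -!lowerE.
congr cp_fun; apply: multiset_ext => y; apply: (can_inj (@sconjK S)).
by rewrite !lower_delta rs.
Qed.

Lemma tame_bifactors (X Y : Type) (r : form S X Y) :
  tame r -> bifactors (form_matrix r).
Proof.
move=> tr; pose t : trel S X Y := exist _ r tr; split.
  exists (fun y => upper t (delta S y)).
  by apply: funext => y; apply: funext => x; rewrite upper_delta.
exists (fun x => lower t (delta S x)).
apply: funext => x; apply: funext => y.
by rewrite /Lambda /mdag -[RHS]sconjK lower_delta.
Qed.

Lemma bifactors_tame (X Y : Type) (r : X -> Y -> S) :
  bifactors r -> tame (hat r).
Proof.
(* [c] lists the columns of [r] and [d] the conjugated rows, so their extensions are the candidates
   for r^* and r_*. *)
move=> [[c rc] [d rd]]; exists (mext d), (mext c).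
have cE x y : c y x = r x y by rewrite -[LHS]/((fun y => mult (c y)) y x) -rc.
have dE x y : d x y = sconj (r x y).
  by rewrite -[LHS]/((fun x => mult (d x)) x y) -rd.
apply/tame_pairE; split=> phi psi.
all: have [s [us sp _]] := covers2 phi phi.
all: have [t [ut tp _]] := covers2 psi psi.
all: rewrite hat_tens (hat_funE r us ut sp tp).
  (* The support of [mext d phi] need not lie in [t]; for the pairing it suffices that [t] covers
     [psi]. *)
  rewrite (cp_funE ut); last by right.
  rewrite exchange_big; apply: eq_bigr => y _ /=.
  rewrite (mextE _ _ us sp) rmorph_sum mulr_suml; apply: eq_bigr => x _.
  by rewrite rmorphM dE sconjK.
rewrite (cp_funE us); last by left.
apply: eq_bigr => x _; rewrite (mextE _ _ ut tp) mulr_sumr.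
by apply: eq_bigr => y _; rewrite cE -mulrA [r x y * _]mulrC.
Qed.

Lemma bifactors_bifinite (X Y : Type) (r : X -> Y -> S) :
  bifactors r <-> bifinite r.
Proof.
(* Conjugation is an involution fixing 0, so [r] and its conjugate have the same support. *)
have dag0 x y : (sconj (r x y) != 0) = (r x y != 0).
  apply/idP/idP; apply: contra_neq => r0; first by rewrite r0 rmorph0.
  by rewrite -[r x y]sconjK r0 rmorph0.
have dagE x : [set y | Lambda (mdag r) x y != 0] = [set y | r x y != 0].
  by apply: funext => y; rewrite /= /Lambda /mdag dag0.
split=> -[].
  move=> /factors_finite fr /factors_finite fd; split=> // x.
  by rewrite -dagE; exact: fd.
by move=> fx fy; split; apply: finite_factors => // x; rewrite dagE.
Qed.

Definition hat_trel (X Y : Type) (r : bifmrel S X Y) : trel S X Y :=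
  exist _ (hat (sval r)) (bifactors_tame (svalP r)).

Lemma form_matrix_hat_trel (X Y : Type) (r : bifmrel S X Y) :
  form_matrix (sval (hat_trel r)) = sval r.
Proof. exact: hatK. Qed.

Lemma hat_trel_bij (X Y : Type) : bijective (@hat_trel X Y).
Proof.
exists (fun r => exist _ _ (tame_bifactors (svalP r))) => r.
  apply: bifmrel_ext => x y.
  exact: (f_equal (fun m => m x y) (form_matrix_hat_trel r)).
by apply: trel_matrix_inj; rewrite form_matrix_hat_trel.
Qed.

(** Tame forms are determined by their matrices, so each functor law reduces to an identity between
    matrix entries. *)
Lemma hat_trel_dagger_iso :
  @is_dagger_iso (BifMRel S) (TRel S) (fun X : Type => X) hat_trel.
Proof.
split=> [|X Y|X|X Y Z s r|X Y r]; first by exists id.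
- exact: hat_trel_bij.
all: apply: trel_matrix_inj; rewrite form_matrix_hat_trel.
all: apply: funext => x; apply: funext => y.
- rewrite [RHS]cp_tens cp_deltal /= /mid.
  by congr (if _ then _ else _); apply/asbool_equiv_eq; split=> ->.
(* An entry of the composite is [cp] of [lower r (delta x)] with [upper s (delta y)]; as the former
   is a conjugated row of [r] and the latter a column of [s], this is the matrix product. *)
- rewrite [RHS]trel_comp_tens -upperE; congr fsum; apply: funext => z.
  by rewrite lower_delta upper_delta !form_matrix_hat_trel.
- by rewrite [RHS]trel_dag_tens cp_deltar upper_delta form_matrix_hat_trel.
Qed.

End TameMatrices.

Theorem proposition4p4 (S : involutiveComSemiRingType) :
  (forall (X Y : Type) (r : X -> Y -> S), tame (hat r) <-> bifactors r)
  /\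
  (forall (X Y : Type) (r : X -> Y -> S), bifactors r <-> bifinite r)
  /\
  exists F : forall X Y : Type,
      @hom (BifMRel S) X Y -> @hom (TRel S) X Y,
    (forall (X Y : Type) (r : @hom (BifMRel S) X Y),
       proj1_sig (F X Y r) = hat (proj1_sig r))
    /\
    @is_dagger_iso (BifMRel S) (TRel S) (fun X : Type => X) F.
Proof.
split=> [X Y r|].
  split; last exact: bifactors_tame.
  by move=> /tame_bifactors; rewrite hatK.
split; first exact: bifactors_bifinite.
exists (@hat_trel S); split=> //.
exact: hat_trel_dagger_iso.
Qed.
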